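(* Let $a\in \mathbb{Q}$, let $c=-a-a^2$, and let $f(x)=x^2+c$. Write $a=\frac{r}{s}$ where $r,s\in \mathbb{Z}$, $s>0$, and $\gcd(r,s)=1$. Assume $a\in(-\infty,-2)\cup(-2,-1)\cup(-1,0)\cup(0,\beta)\cup(1,\infty)$, where $\beta=\frac{1}{3}\left(-2+(19-3\sqrt{33})^{1/3}+(19+3\sqrt{33})^{1/3}\right)\approx 0.839$, and define \[ \delta=\begin{cases}0 & \text{if } a\in(-\infty,-2)\cup(-2,-1)\cup(-1,0)\cup(1,\infty),\\ 1 & \text{if } a\in(0,\beta),\end{cases} \qquad e=\begin{cases}0 & \text{if } v_2(a)\le 0,\\ 1 & \text{if } v_2(a)>0.\end{cases} \] Suppose $a-c$ is not a square in $\mathbb{Q}$ and at least one of the following holds: (1) $(-1)^\delta 2^e|r|\equiv 2 \pmod 3$; (2) $(-1)^\delta 2^e|r|\equiv 3\pmod 4$; (3) $(-1)^\delta 2^e|r|$ is not a quadratic residue modulo $q$ for some prime $q$ dividing $s$. Then the arboreal Galois representation $\mathrm{Gal}(\bar{\mathbb{Q}}/\mathbb{Q})\to \mathrm{Aut}(T)$ associated to $f$ and $a$ is surjective.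
   Context: $v_2$ denotes the $2$-adic valuation on $\mathbb{Q}$. For $f\in\mathbb{Q}[x]$ of degree $2$ and $a\in\mathbb{Q}$, the backward orbit of $a$ is $\mathcal{O}^-(a)=\{\beta\in\bar{\mathbb{Q}}: f^n(\beta)=a \text{ for some } n\ge 0\}$ ($f^n$ the $n$-th iterate, $f^0$ the identity). It is given the structure of a rooted tree $T$: the root is $a$, the vertices at level $n$ are the elements of $f^{-n}(a)$, and there is an edge between $\beta$ and $f(\beta)$; when $a$ is not in the forward orbit of the critical point $0$ this is the complete regular binary rooted tree. The absolute Galois group $\mathrm{Gal}(\bar{\mathbb{Q}}/\mathbb{Q})$ acts on $\mathcal{O}^-(a)$ by tree automorphisms, giving a homomorphism $\mathrm{Gal}(\bar{\mathbb{Q}}/\mathbb{Q})\to\mathrm{Aut}(T)$, the arboreal Galois representation; its image is isomorphic to $\mathrm{Gal}(\mathbb{Q}(\mathcal{O}^-(a))/\mathbb{Q})$. *)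

(* Defs.v *)
From HB Require Import structures.
From mathcomp Require Import all_boot all_order all_algebra all_field.
From mathcomp Require Import boolp classical_sets.

Set Implicit Arguments.
Unset Strict Implicit.
Unset Printing Implicit Defensive.

Import Order.TTheory GRing.Theory Num.Theory.

Local Open Scope classical_set_scope.
Local Open Scope ring_scope.

(* Automorphisms of a graph (V, adj) fixing the vertex [root]. *)
Record rooted_aut (V : Type) (root : V) (adj : V -> V -> Prop) := RootedAut {
  raut_fun :> V -> V;
  raut_bij : bijective raut_fun;
  raut_root : raut_fun root = root;
  raut_adj : forall u v, adj (raut_fun u) (raut_fun v) <-> adj u v
}.

Lemma rooted_autP (V : Type) (root : V) (adj : V -> V -> Prop)
    (s t : rooted_aut root adj) : s =1 t -> s = t.
Proof.
case: s t => [s sb sr sa] [t tb tr ta] /= /funext st.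
by case: t / st tb tr ta => tb tr ta; congr RootedAut; apply: Prop_irrelevance.
Qed.

(* [algC] is the algebraic closure of Q.  Ring endomorphisms of [algC] fix Q  *)
(* and are bijective ([algC_autK], [algC_invautK]), so they are exactly the   *)
(* elements of Gal(Qbar/Q).                                                   *)
Definition absGalQ := {rmorphism algC -> algC}.

Section Arboreal.

Variables (f : {poly rat}) (a : rat).

Definition fC (x : algC) : algC := (map_poly ratr f).[x].

Definition backward_orbit : set algC :=
  [set b | exists n, iter n fC b = ratr a].

Definition tree_vertex : Type := backward_orbit.

Lemma root_subproof : ratr a \in backward_orbit.
Proof. by apply/mem_set; exists 0%N. Qed.

Definition tree_root : tree_vertex := exist _ (ratr a) root_subproof.

Definition tree_adj (u v : tree_vertex) : Prop :=
  val v = fC (val u) \/ val u = fC (val v).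

Definition tree_aut := rooted_aut tree_root tree_adj.

Lemma fC_gal (g : absGalQ) x : fC (g x) = g (fC x).
Proof.
rewrite /fC -horner_map -map_poly_comp; congr (_.[_]).
by apply: eq_map_poly => q /=; rewrite fmorph_rat.
Qed.

Lemma gal_vertex (g : absGalQ) x : x \in backward_orbit -> g x \in backward_orbit.
Proof.
move=> /set_mem[n xa]; apply/mem_set; exists n.
rewrite -(fmorph_rat g) -xa; elim: n {xa} => //= n ->.
exact: fC_gal.
Qed.

Definition gal_act (g : absGalQ) (u : tree_vertex) : tree_vertex :=
  exist _ (g (val u)) (gal_vertex g (valP u)).

Lemma gal_act_bij g : bijective (gal_act g).
Proof.
exists (gal_act (algC_invaut g)) => u; apply: val_inj => /=.
  exact: algC_autK.
exact: algC_invautK.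
Qed.

Lemma gal_act_root g : gal_act g tree_root = tree_root.
Proof. by apply: val_inj; rewrite /= fmorph_rat. Qed.

Lemma gal_act_adj g u v : tree_adj (gal_act g u) (gal_act g v) <-> tree_adj u v.
Proof.
rewrite /tree_adj /= !fC_gal.
by split=> -[E|E]; [left|right|left|right]; rewrite ?E //; apply: fmorph_inj E.
Qed.

Definition arboreal_rep (g : absGalQ) : tree_aut :=
  RootedAut (gal_act_bij g) (gal_act_root g) (gal_act_adj g).

Lemma arboreal_repM (g h : absGalQ) (u : tree_vertex) :
  arboreal_rep (g \o h : {rmorphism _ -> _}) u =
  arboreal_rep g (arboreal_rep h u).
Proof. exact: val_inj. Qed.

End Arboreal.

(* The value at x = 0 is junk (0 instead of +oo). *)
Definition valq (p : nat) (x : rat) : int :=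
  (logn p `|numq x|)%:Z - (logn p `|denq x|)%:Z.

(* A real element of [algC]: [3.-root] of a positive real is its positive     *)
(* real cube root, and 19 - 3 sqrt 33 > 0.  On reals, the order of [algC] is  *)
(* the usual one.                                                             *)
Definition beta : algC :=
  3^-1 * (- 2 + 3.-root (19 - 3 * sqrtC 33) + 3.-root (19 + 3 * sqrtC 33)).

Definition range0 (a : rat) : bool :=
  [|| a < - 2, - 2 < a < - 1, - 1 < a < 0 | 1 < a].

Definition range1 (a : rat) : bool := (0 < a) && (ratr a < beta).

(* Only meaningful on [range0] and [range1], which are disjoint. *)
Definition delta (a : rat) : nat := if range1 a then 1 else 0.

Definition eps (a : rat) : nat := if 0 < valq 2 a then 1 else 0.

Definition quad_residue (q m : int) : Prop :=
  exists x : int, (x ^+ 2 = m %[mod q])%Z.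

(* Main.v *)
From HB Require Import structures.
Require Import Defs.
From mathcomp Require Import boolp classical_sets filter.
From mathcomp Require Import all_boot all_order all_algebra all_fingroup.
From mathcomp Require Import all_solvable all_field.
From mathcomp Require Import zify ring lra.

Set Implicit Arguments.
Unset Strict Implicit.
Unset Printing Implicit Defensive.

Import Order.TTheory GRing.Theory Num.Theory.

(** The automorphisms of the binary tree of depth [n] form a finite 2-group [A].
    A proper subgroup lies in a subgroup of index 2, that is, in the kernel of a
    quadratic character of [A].  Since [A] is generated by the swaps at a single
    vertex and two swaps at the same level are conjugate, such a character is a
    product of the level signs [chi i] (parity of the number of swaps at level
    [i]).  A Galois automorphism acts on a square root of [d_i], where
    [d_0 = a - c] and [d_i = f^i(c) - a], through [chi i], so the Galois group is
    everything at depth [n] as soon as no nonempty product of the [d_i] is a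
    rational square (Stoll's criterion).  Compactness of the Galois group
    then handles the infinite tree.

    Here [f(a) = f(-a) = -a] gives [f(x) + a = (x - a)(x + a)], whence
    [f^n(0) - a] is [- a] times [2 + a \prod_(0 < j < n) (f^j(0) - a)]: up to
    powers of 2 these cofactors are pairwise coprime and coprime to [r s].  If a
    product of some [d_i] is a square, then [d_i] is [m] times a square for each
    [i > 0] involved, the sign [(-1)^delta] being read off the real dynamics, and
    this is impossible modulo 3, 4 or [q]. *)

(** * Automorphisms of the finite binary tree *)

(** Membership in a subgroup of index 2 behaves as a quadratic character: two elements outside [M]
    multiply into [M]. *)
Lemma index2_memM (gT : finGroupType) (G M : {group gT}) x y :
  M \subset G -> #|G : M|%g = 2 -> x \in G -> y \in G ->
  ((x * y)%g \in M) = ((x \in M) == (y \in M)).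
Proof.
move=> sMG iM xG yG; have [xM|xM] := boolP (x \in M); first by rewrite groupMl.
have [yM|yM] := boolP (y \in M); first by rewrite groupMr // (negbTE xM).
have yVD : y^-1%g \in G :\: M by rewrite !inE !groupV yM.
by rewrite -[y]invgK -mem_rcoset (rcoset_index2 sMG iM yVD) !inE xM.
Qed.

Section BinaryTree.

Variable n : nat.

(** A leaf is the word of binary choices on its path from the root. A vertex at level [i] is the
    class of leaves that share their first [i] bits, a relation tested by [agree i]. *)
Definition leaf := {ffun 'I_n -> bool}.

Implicit Types (w v m : leaf) (i j k : 'I_n) (g h : {perm leaf}).

Definition agree (i : nat) v w := [forall k : 'I_n, (k < i) ==> (v k == w k)].

Lemma agreeP (i : nat) v w :
  reflect (forall k, k < i -> v k = w k) (agree i v w).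
Proof.
apply: (iffP forallP) => H k; last by apply/implyP => ki; rewrite H.
by move=> ki; apply/eqP; move: (H k); rewrite ki.
Qed.

Lemma agree_refl (i : nat) w : agree i w w.
Proof. exact/agreeP. Qed.

Lemma agree_sym (i : nat) v w : agree i v w = agree i w v.
Proof. by apply/agreeP/agreeP => H k /H. Qed.

Lemma agree_eql (i : nat) u v w : agree i u v -> agree i u w = agree i v w.
Proof.
by move=> /agreeP H; apply/agreeP/agreeP => H' k ki; rewrite -H' ?H // -H.
Qed.

Lemma agreeW (i j : nat) v w : i <= j -> agree j v w -> agree i v w.
Proof. by move=> ij /agreeP H; apply/agreeP => k /leq_trans/(_ ij)/H. Qed.

Lemma agree_full v w : agree n v w -> v = w.
Proof. by move=> /agreeP H; apply/ffunP => k; apply: H. Qed.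

Lemma agreeS i v w : agree i.+1 v w = agree i v w && (v i == w i).
Proof.
apply/idP/andP => [H|[/agreeP H /eqP Hi]].
  by split; [apply: agreeW H | apply/eqP; move/agreeP: H; apply].
apply/agreeP => k; rewrite ltnS leq_eqVlt => /orP[/eqP/val_inj->//|]; exact: H.
Qed.

Definition tree_perms :=
  [set g : {perm leaf} | [forall i : 'I_n, forall v, forall w,
     agree i v w ==> agree i (g v) (g w)]].

Lemma tree_permsP g :
  reflect (forall i v w, agree i v w -> agree i (g v) (g w))
          (g \in tree_perms).
Proof.
rewrite inE; apply: (iffP 'forall_forallP) => H i v.
  by move=> w; move: (H i v) => /forallP/(_ w)/implyP.
by apply/forallP => w; apply/implyP; apply: H.
Qed.

Lemma tree_perm_agree (i : nat) g v w :
  g \in tree_perms -> agree i v w -> agree i (g v) (g w).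
Proof.
move=> /tree_permsP gA; have [ilt|nlt] := ltnP i n.
  exact: (gA (Ordinal ilt)).
by move=> /(agreeW nlt)/agree_full ->; apply: agree_refl.
Qed.

Lemma tree_perms_group_set : group_set tree_perms.
Proof.
apply/group_setP; split=> [|g h gA hA]; apply/tree_permsP => i v w.
  by rewrite !perm1.
by rewrite !permM => /(tree_perm_agree gA)/(tree_perm_agree hA).
Qed.

Canonical tree_perms_group := Group tree_perms_group_set.

(** Whether [g] exchanges the two subtrees at a vertex can be read on any leaf below it; hence [chi]
    may use one leaf per vertex. *)
Lemma tree_perm_flip g i v w : g \in tree_perms -> agree i v w ->
  g v i (+) v i = g w i (+) w i.
Proof.
move=> gA vw; have gvw := tree_perm_agree gA vw.
have [vwi|] := eqVneq (v i) (w i).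
  have: agree i.+1 v w by rewrite agreeS vw vwi /=.
  by move/(tree_perm_agree gA); rewrite agreeS => /andP[_ /eqP->]; rewrite vwi.
have [gvwi|] := eqVneq (g v i) (g w i).
  have: agree i.+1 (g v) (g w) by rewrite agreeS gvw gvwi /=.
  have gVA : (g^-1)%g \in tree_perms by rewrite groupV.
  by move/(tree_perm_agree gVA); rewrite !permK agreeS => /andP[_ ->].
by case: (v i); case: (w i); case: (g v i); case: (g w i).
Qed.

(** Exchanges the two subtrees below the level [i] vertex that lies above [v]. *)
Definition swap_fun i v w : leaf :=
  [ffun k => w k (+) ((k == i) && agree i v w)].

Lemma agree_swap i v w : agree i w (swap_fun i v w).
Proof.
by apply/agreeP => k ki; rewrite ffunE; case: eqP ki => [->|]; rewrite ?ltnn ?addbF.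
Qed.

Lemma swap_funK i v : involutive (swap_fun i v).
Proof.
move=> w; have E : agree i v (swap_fun i v w) = agree i v w.
  by rewrite agree_sym -(agree_eql _ (agree_swap i v w)) agree_sym.
by apply/ffunP => k; rewrite ffunE E ffunE addbK.
Qed.

Definition swap i v : {perm leaf} := perm (inv_inj (swap_funK i v)).

Lemma swap_tree i v : swap i v \in tree_perms.
Proof.
apply/tree_permsP => j u w /agreeP uw; apply/agreeP => k kj; rewrite !permE !ffunE.
rewrite uw //; case: eqP => // ki; congr (_ (+) _); rewrite /= agree_sym [RHS]agree_sym.
by apply: agree_eql; apply/agreeP => l li; apply: uw; rewrite (ltn_trans li) // -ki.
Qed.

(** Translations are transitive on leaves and preserve [agree], so they conjugate any two swaps of
    the same level. *)
Definition shift_fun m w : leaf := [ffun k => w k (+) m k].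

Lemma shift_funK m : involutive (shift_fun m).
Proof. by move=> w; apply/ffunP => k; rewrite !ffunE addbK. Qed.

Definition shift m : {perm leaf} := perm (inv_inj (shift_funK m)).

Lemma agree_shift (i : nat) m v w :
  agree i (shift_fun m v) (shift_fun m w) = agree i v w.
Proof.
apply/agreeP/agreeP => H k /H; rewrite !ffunE; last by move->.
by move/addIb.
Qed.

Lemma shift_tree m : shift m \in tree_perms.
Proof. by apply/tree_permsP => i v w; rewrite !permE agree_shift. Qed.

Lemma swap_conj i v m : (swap i v ^ shift m)%g = swap i (shift_fun m v).
Proof.
suff: (swap i v * shift m = shift m * swap i (shift_fun m v))%g.
  by move=> E; rewrite conjgE E mulKg.
apply/permP => w; rewrite !permM !permE; apply/ffunP => k.
by rewrite !ffunE agree_shift addbAC.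
Qed.

Lemma swap_conj_all i v w : exists2 g, g \in tree_perms & swap i w = (swap i v ^ g)%g.
Proof.
exists (shift [ffun k => v k (+) w k]); first exact: shift_tree.
by rewrite swap_conj; congr swap; apply/ffunP => k; rewrite !ffunE addKb.
Qed.

(** Clearing the bits from [i] on picks one leaf below each level [i] vertex, so [level i] indexes
    these vertices. *)
Definition trunc (i : nat) w : leaf := [ffun k : 'I_n => (k < i) && w k].

Definition level (i : nat) := [set w | trunc i w == w].

Lemma agree_trunc (i : nat) w : agree i w (trunc i w).
Proof. by apply/agreeP => k ki; rewrite ffunE ki. Qed.

Lemma trunc_level (i : nat) w : trunc i w \in level i.
Proof.
rewrite inE; apply/eqP/ffunP => k; rewrite !ffunE.
by case: (k < i).
Qed.

Lemma trunc_eq (i : nat) v w : agree i v w -> trunc i v = trunc i w.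
Proof.
move=> /agreeP H; apply/ffunP => k; rewrite !ffunE.
by case: ltnP => //= /H.
Qed.

Lemma levelP (i : nat) w :
  reflect (forall k, i <= k -> w k = false) (w \in level i).
Proof.
rewrite inE; apply: (iffP eqP) => [<- k ik|wi]; first by rewrite ffunE ltnNge ik.
by apply/ffunP => k; rewrite ffunE; case: ltnP => //= /wi.
Qed.

Lemma level_bit (i : nat) (k : 'I_n) w : w \in level i -> i <= k -> w k = false.
Proof. by move=> /levelP; apply. Qed.

Lemma level_eq (i : nat) v w : v \in level i -> w \in level i -> agree i v w -> v = w.
Proof. by rewrite !inE => /eqP {2}<- /eqP {2}<-; apply: trunc_eq. Qed.

Lemma big_level_perm (R : Type) (idx : R) (op : Monoid.com_law idx) (i : nat)
    (F : leaf -> R) g : g \in tree_perms ->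
  \big[op/idx]_(w in level i) F (trunc i (g w)) = \big[op/idx]_(w in level i) F w.
Proof.
move=> gA; set t := fun w => trunc i (g w).
have t_inj : {in level i &, injective t}.
  move=> v w vL wL tvw; apply: (level_eq vL wL).
  have gVA : (g^-1)%g \in tree_perms by rewrite groupV.
  rewrite -[v](permK g) -[w](permK g); apply: tree_perm_agree => //.
  rewrite (agree_eql _ (agree_trunc i _)) -/(t v) tvw agree_sym; exact: agree_trunc.
rewrite -(big_imset F t_inj); congr (bigop.body _ _ _).
suff -> : t @: level i = level i by [].
apply/eqP; rewrite eqEcard (card_in_imset t_inj) leqnn andbT.
by apply/subsetP => _ /imsetP[w _ ->]; apply: trunc_level.
Qed.

(** Leaves of [level i] have bit [i] clear, so this is the parity of the number of level [i]
    vertices at which [g] exchanges the subtrees. *)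
Definition chi i g := \big[addb/false]_(w in level i) g w i.

Lemma chiM i g h : g \in tree_perms -> h \in tree_perms ->
  chi i (g * h) = chi i g (+) chi i h.
Proof.
move=> gA hA; rewrite addbC {2}/chi -(big_level_perm _ i (fun w => h w i) gA).
rewrite /chi -big_split; apply: eq_bigr => w _ /=; rewrite permM.
have /= := tree_perm_flip hA (agree_trunc i (g w)).
by rewrite [trunc i (g w) i]ffunE ltnn addbF => <-; rewrite addbK.
Qed.

Lemma chi_swap i j v : chi i (swap j v) = (i == j).
Proof.
rewrite /chi; case: eqP => [->|/eqP ij]; last first.
  apply: big1 => w wL; rewrite permE ffunE (negbTE ij) addbF.
  exact: level_bit wL _.
rewrite (bigD1 (trunc j v)) ?trunc_level //= big1 ?addbF.
  by rewrite permE !ffunE eqxx ltnn /= agree_trunc.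
move=> w /andP[wL wv]; rewrite permE ffunE eqxx (level_bit wL) //=.
apply: contraNF wv => vw; apply/eqP; apply: (level_eq wL (trunc_level _ _)).
by rewrite -(agree_eql _ vw) agree_trunc.
Qed.

Definition swaps := [set swap p.1 p.2 | p : 'I_n * leaf].

(** Levels are straightened from the top down, [k] counting those left. At the first of them, [j],
    composing with a swap removes one vertex from the set [W] of flipped vertices; once [W] is
    empty, [g] fixes one more level. *)
Lemma tree_perms_gen : tree_perms \subset <<swaps>>%g.
Proof.
have inS i v : swap i v \in <<swaps>>%g.
  by rewrite mem_gen //; apply/imsetP; exists (i, v).
suff H (k : nat) : k <= n -> forall g, g \in tree_perms ->
    (forall w, agree (n - k) w (g w)) -> g \in <<swaps>>%g.
  by apply/subsetP => g gA; apply: (H n) => // w; rewrite subnn; apply/agreeP.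
elim: k => [|k IHk] kn g gA gfix.
  rewrite (_ : g = 1%g) ?group1 //; apply/permP => w; rewrite perm1.
  by symmetry; apply: agree_full; rewrite -[n in agree n]subn0.
have jn : n - k.+1 < n by rewrite ltn_subrL (leq_ltn_trans _ kn).
pose j := Ordinal jn; pose W g' := [set w in level j | g' w j].
have memW h w : (w \in W h) = (w \in level j) && h w j by rewrite inE.
have Sj : n - k = j.+1 by rewrite /= -subSn.
have [N] := ubnP #|W g|; elim: N => // N IHN in g gA gfix *; rewrite ltnS => WN.
have [W0|[v]] := set_0Vmem (W g).
  apply: IHk => //; first exact: ltnW.
  move=> w; rewrite Sj agreeS gfix /=.
  have /= := tree_perm_flip gA (agree_trunc j w).
  have: trunc j w \notin W g by rewrite W0 inE.
  rewrite memW trunc_level /= => /negbTE ->; rewrite ffunE ltnn /=.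
  by move/eqP; rewrite eq_sym; case: (w j); case: (g w j).
rewrite memW => /andP[vL gvj].
rewrite -(groupMl _ (inS j v)); apply: IHN.
- by rewrite groupM // swap_tree.
- move=> w; rewrite permM permE agree_sym -(agree_eql _ (gfix _)) agree_sym.
  exact: agree_swap.
- apply: leq_trans WN; apply: proper_card; apply/properP; split; last first.
    exists v; rewrite !memW vL //= permM permE.
    have := tree_perm_flip gA (agree_swap j v v).
    rewrite gvj (level_bit vL) // !ffunE eqxx agree_refl (level_bit vL) //=.
    by rewrite addbT => <-.
  apply/subsetP => w; rewrite !memW => /andP[wL]; rewrite wL /= permM permE.
  have [vw|vw] := boolP (agree j v w); last first.
    rewrite (_ : swap_fun j v w = w) //; apply/ffunP => l; rewrite ffunE.
    by rewrite (negbTE vw) andbF addbF.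
  by rewrite -(level_eq vL wL vw).
Qed.

(** If [h] fixes the first [k] bits, its square flips bit [k] twice or not at all, so each squaring
    fixes one more level. *)
Lemma tree_perm_exp (k : nat) g w :
  g \in tree_perms -> agree k w ((g ^+ (2 ^ k))%g w).
Proof.
move=> gA; elim: k w => [|k IHk] w; first exact/agreeP.
have hA : (g ^+ (2 ^ k))%g \in tree_perms by rewrite groupX.
rewrite expnSr expgM; move: (g ^+ _)%g hA IHk => h hA IHk.
have [kn|nk] := ltnP k n; last first.
  rewrite expgS expg1 permM -!(agree_full (agreeW nk (IHk _))); exact/agreeP.
rewrite -[k]/(val (Ordinal kn)) agreeS expgS expg1 permM.
rewrite agree_sym -(agree_eql _ (IHk _)) agree_sym IHk /=; apply/eqP.
have := tree_perm_flip (i := Ordinal kn) hA (IHk w).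
by case: (w _); case: (h w _); case: (h (h w) _).
Qed.

Lemma tree_perms_2group : (2.-group tree_perms)%g.
Proof.
rewrite -pnat_exponent; apply: (@pnat_dvd _ (2 ^ n)); last by rewrite pnatX pnat_id.
apply/exponentP => g gA; apply/permP => w; rewrite perm1.
exact/esym/agree_full/tree_perm_exp.
Qed.

(* A proper subgroup of a 2-group lies in a subgroup of index 2, and the       *)
(* quadratic characters of the full tree group are products of the [chi i].    *)
Lemma tree_perms_subgroup (H : {group {perm leaf}}) :
  H \subset tree_perms ->
  (forall S : {set 'I_n}, S != set0 ->
     exists2 h, h \in H & \big[addb/false]_(i in S) chi i h) ->
  H :=: tree_perms.
Proof.
move=> sHA charH; case: (maximal_exists sHA) => // -[M maxM sHM].
have pA := tree_perms_2group.
have iM := p_maximal_index pA maxM.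
have /andP[sMA nMA] := p_maximal_normal pA maxM.
have memM := index2_memM sMA iM.
pose z : leaf := [ffun=> false].
have swapM i v : (swap i v \in M) = (swap i z \in M).
  have [g gA ->] := swap_conj_all i z v.
  by rewrite memJ_norm // (subsetP nMA).
(* [S] collects the levels whose swaps lie outside [M]. On [K] the character of [M] agrees with the
   product of the [chi i] over [S]; [K] is a group containing all swaps, hence everything. *)
pose S := [set i | swap i z \notin M].
pose K := [set g in tree_perms | (g \in M) == ~~ \big[addb/false]_(i in S) chi i g].
have memK g : (g \in K) =
    (g \in tree_perms) && ((g \in M) == ~~ \big[addb/false]_(i in S) chi i g).
  by rewrite inE.
have KG : group_set K.
  apply/group_setP; split=> [|g h].
    rewrite memK !group1 big1 // => i _; apply: big1 => w wL.
    by rewrite perm1 (level_bit wL).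
  rewrite !memK => /andP[gA /eqP gM] /andP[hA /eqP hM].
  rewrite groupM //= memM // gM hM.
  rewrite (eq_bigr (fun i => chi i g (+) chi i h)); last by move=> i _; apply: chiM.
  by rewrite big_split /=; do 2!case: (\big[_/_]_(_ in _) _).
have sAK : tree_perms \subset Group KG.
  apply: subset_trans tree_perms_gen _; rewrite gen_subG.
  apply/subsetP => _ /imsetP[[i v] _ ->] /=; rewrite memK swap_tree swapM /=.
  have [iS|iS] := boolP (i \in S).
    rewrite (bigD1 i) //= chi_swap eqxx big1 => [|j /andP[_ /negbTE ji]].
      by move: iS; rewrite inE => /negbTE ->.
    by rewrite chi_swap.
  rewrite big1 => [|j jS]; first by move: iS; rewrite inE negbK => ->.
  by rewrite chi_swap; apply: contraNF iS => /eqP <-.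
have [S0|/charH[h hH]] := eqVneq S set0.
  have sAM : tree_perms \subset M.
    apply: subset_trans tree_perms_gen _; rewrite gen_subG.
    apply/subsetP => _ /imsetP[[i v] _ ->] /=; rewrite swapM.
    by apply: contraTT isT => iM'; have: i \in S by [rewrite inE]; rewrite S0 inE.
  by move: sAM; rewrite -indexg_eq1 iM.
have hA := subsetP sHA h hH.
have:= subsetP sAK h hA; rewrite memK (subsetP sHM) // hA /=.
by case: (\big[_/_]_(_ in _) _).
Qed.

End BinaryTree.

Local Open Scope ring_scope.

(** * Galois action on the preimages of a point *)

Lemma conj_sqrt_rat (x : algC) (d : rat) :
  x ^+ 2 = ratr d -> x \notin Crat -> exists g : absGalQ, g x = - x.
Proof.
move=> x2 xNQ; have [Qx [QxC [[|x1 []] // [Dx]]] genQx] := num_field_exists [:: x].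
have x1N1 : x1 \notin (1%AS : {subfield Qx}).
  apply: contra xNQ => /vlineP[q x1q]; apply/CratP; exists q.
  by rewrite -Dx x1q alg_num_field fmorph_rat.
have x12 : x1 ^+ 2 = d%:A.
  by apply: (fmorph_inj QxC); rewrite rmorphXn /= Dx x2 alg_num_field fmorph_rat.
have hom1 : kHom 1 1 (\1%VF : 'End(Qx)) by rewrite kHom1.
have idp (p : {poly Qx}) : map_poly \1%VF p = p.
  by rewrite map_polyE map_id_in ?polyseqK // => ? _; rewrite id_lfunE.
(* The minimal polynomial divides [(X - x1)(X + x1)]; if [- x1] were not a root, it would divide
   [X - x1] and [x1] would be rational. *)
have rNx1 : root (map_poly \1%VF (minPoly 1%AS x1)) (- x1).
  rewrite idp; apply: contraNT x1N1 => Nroot.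
  suff E : size (minPoly 1%AS x1) = size ('X - x1%:P).
    by rewrite -adjoin_deg_eq1 -eqSS -size_minPoly E size_XsubC.
  apply/eqP; rewrite eqn_leq.
  rewrite [X in _ && X]dvdp_leq ?monic_neq0 ?monic_minPoly // ?andbT; last first.
    by rewrite dvdp_XsubCl root_minPoly.
  rewrite dvdp_leq ?polyXsubC_eq0 //.
  rewrite -(@Gauss_dvdpl _ _ ('X - (- x1)%:P)); last first.
    by rewrite coprimep_XsubC.
  apply: minPoly_dvdp; last by rewrite rootM root_XsubC eqxx.
  rewrite polyCN opprK -subr_sqr -rmorphXn /= x12.
  by rewrite rpredB ?rpredX ?polyOverX // polyOverC rpredZ // rpred1.
pose phi := kHomExtend 1 \1 x1 (- x1).
have phim : monoid_morphism phi.
  by apply/kHom_monoid_morphism; rewrite -genQx span_seq1 /= kHomExtendP.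
pose phimM := GRing.isMonoidMorphism.Build _ _ phi phim.
pose phiRM : {rmorphism _ -> _} := HB.pack (fun_of_lfun phi) phimM.
have [nu Dnu] := extend_algC_subfield_aut QxC phiRM.
exists nu; rewrite -Dx -Dnu /= -[in LHS](hornerX x1) /phi.
by rewrite (kHomExtend_poly hom1) ?polyOverX // idp hornerX rmorphN.
Qed.

Lemma prod_signr (R : comPzRingType) (I : finType) (P : pred I) (F : I -> bool) :
  \prod_(i | P i) (-1) ^+ F i = (-1) ^+ (\big[addb/false]_(i | P i) F i) :> R.
Proof.
symmetry; apply: (big_morph (fun b : bool => (-1) ^+ b)) => // b b'.
by rewrite signr_addb.
Qed.

Section Labelling.

Variables (a c : rat) (n : nat).

Definition quad (x : algC) : algC := x ^+ 2 + ratr c.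

(** The bits of [b] choose the sign of a fixed square root at each level, which labels iterated
    preimages of [a] by words. *)
Fixpoint node (b : nat -> bool) (i : nat) : algC :=
  if i is j.+1 then (-1) ^+ b j * sqrtC (node b j - ratr c) else ratr a.

Lemma quad_node b i : quad (node b i.+1) = node b i.
Proof. by rewrite /quad /= exprMn sqrr_sign mul1r sqrtCK subrK. Qed.

Lemma eq_node b b' i : (forall k, (k < i)%N -> b k = b' k) -> node b i = node b' i.
Proof.
elim: i => //= i IHi bb'; rewrite bb' // IHi // => k ki; apply: bb'.
exact: leqW.
Qed.

Lemma iter_quad_node b i j : (j <= i)%N -> iter (i - j) quad (node b i) = node b j.
Proof.
elim: i => [|i IHi]; first by rewrite leqn0 => /eqP->.
rewrite leq_eqVlt => /orP[/eqP->|ji]; first by rewrite subnn.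
by rewrite subSn // iterSr quad_node IHi.
Qed.

Lemma node_surj i x : iter i quad x = ratr a -> exists b, node b i = x.
Proof.
elim: i x => [|i IHi] x; first by exists (fun=> false).
rewrite iterSr => /IHi[b bx].
have xs : x ^+ 2 == sqrtC (node b i - ratr c) ^+ 2 by rewrite bx sqrtCK addrK.
pose b' e k := if (k == i)%N then e else b k.
have nb' e : node (b' e) i.+1 = (-1) ^+ e * sqrtC (node b i - ratr c).
  rewrite /= {1}/b' eqxx; congr (_ * sqrtC (_ - _)); apply: eq_node => k ki.
  by rewrite /b' ltn_eqF.
by move: xs; rewrite eqf_sqr => /orP[] /eqP->;
  [exists (b' false) | exists (b' true)]; rewrite nb' ?expr0 ?mul1r ?expr1 ?mulN1r.
Qed.

Hypothesis nodeNc : forall b i, (i < n)%N -> node b i != ratr c.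

Lemma node_inj b b' i : (i <= n)%N -> node b i = node b' i ->
  forall k, (k < i)%N -> b k = b' k.
Proof.
elim: i => // i IHi ilt bb' k; rewrite ltnS leq_eqVlt.
have bb'i : node b i = node b' i by rewrite -(quad_node b) bb' quad_node.
case/orP => [/eqP->|]; last by apply: IHi => //; apply: ltnW.
move: bb'; rewrite /= bb'i => /mulIf; rewrite sqrtC_eq0 subr_eq0 => /(_ (nodeNc b' ilt)).
exact: signr_inj.
Qed.

Definition bit (w : leaf n) (k : nat) := oapp w false (insub k).

Lemma bitE w (k : 'I_n) : bit w k = w k.
Proof. by rewrite /bit valK. Qed.

Definition vertex w := node (bit w).

Lemma vertex_agree (i : nat) v w : agree i v w -> vertex v i = vertex w i.
Proof.
move=> /agreeP vw; apply: eq_node => k ki; rewrite /bit.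
by case: insubP => //= k' _ kk'; apply: vw; rewrite kk'.
Qed.

Lemma vertex_inj (i : nat) v w :
  (i <= n)%N -> vertex v i = vertex w i -> agree i v w.
Proof.
move=> ilt vw; apply/agreeP => k ki; rewrite -!bitE; exact: node_inj vw _ ki.
Qed.

Lemma vertexS w (i : 'I_n) :
  vertex w i.+1 = (-1) ^+ w i * sqrtC (vertex w i - ratr c).
Proof. by rewrite -bitE. Qed.

Lemma vertex_surj i x :
  (i <= n)%N -> iter i quad x = ratr a -> exists w, vertex w i = x.
Proof.
move=> ile /node_surj[b <-]; exists [ffun k : 'I_n => b k]; apply: eq_node => k ki.
by rewrite -[k]/(val (Ordinal (leq_trans ki ile))) bitE ffunE.
Qed.

Lemma iter_sub_vertex w i : (i <= n)%N ->
  iter (n - i) quad (vertex w n) = vertex w i.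
Proof. exact: iter_quad_node. Qed.

Lemma iter_quad_vertex w i : (i <= n)%N -> iter i quad (vertex w i) = ratr a.
Proof. by move=> ilt; rewrite -[i in iter i]subn0 iter_quad_node. Qed.

(** Stated for a bare function [phi] so as to cover both Galois automorphisms and arbitrary tree
    automorphisms. *)
Lemma tree_map_perm (phi : algC -> algC) :
  phi (ratr a) = ratr a ->
  (forall x y, iter n quad x = ratr a -> iter n quad y = ratr a ->
     phi x = phi y -> x = y) ->
  (forall w i, (i < n)%N -> phi (quad (vertex w i.+1)) = quad (phi (vertex w i.+1))) ->
  exists2 p, p \in tree_perms n &
    forall w i, (i <= n)%N -> vertex (p w) i = phi (vertex w i).
Proof.
move=> phi_a phi_inj phi_quad.
have phi_iter w i : (i <= n)%N ->
    iter (n - i) quad (phi (vertex w n)) = phi (vertex w i).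
  move=> ile; rewrite -{2}(subKn ile); move: (n - i)%N (leq_subr i n) => k kn.
  elim: k kn => [|k IHk] kn; first by rewrite subn0.
  have E : (n - k = (n - k.+1).+1)%N by rewrite subnSK.
  by rewrite iterS IHk ?(ltnW kn) // E -phi_quad ?quad_node // -E leq_subr.
have ex w : exists w', vertex w' n == phi (vertex w n).
  have [||w' <-] := @vertex_surj n (phi (vertex w n)) => //; last by exists w'.
  by rewrite -[n in iter n]subn0 phi_iter.
pose q w := xchoose (ex w).
have qE w i : (i <= n)%N -> vertex (q w) i = phi (vertex w i).
  move=> ile; rewrite -phi_iter // -(eqP (xchooseP (ex w))).
  by rewrite iter_quad_node.
have q_inj : injective q.
  move=> v w vw; apply: agree_full; apply: vertex_inj => //.
  by apply: phi_inj; rewrite ?iter_quad_vertex // -!qE // vw.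
exists (perm q_inj); last by move=> w i ile; rewrite permE qE.
apply/tree_permsP => i v w vw; rewrite !permE.
have ile := ltnW (ltn_ord i).
by apply: vertex_inj => //; rewrite !qE ?(vertex_agree vw).
Qed.

Lemma gal_iter_quad (g : absGalQ) k x : iter k quad (g x) = g (iter k quad x).
Proof.
elim: k => //= k ->; by rewrite /quad rmorphD rmorphXn /= fmorph_rat.
Qed.

Lemma gal_perm (g : absGalQ) : exists2 p, p \in tree_perms n &
  forall w i, (i <= n)%N -> vertex (p w) i = g (vertex w i).
Proof.
apply: tree_map_perm => [|x y _ _|w i _]; first exact: fmorph_rat.
  exact: fmorph_inj.
exact: esym (gal_iter_quad g 1 _).
Qed.

Definition gal_perms :=
  [set p in tree_perms n |
   `[< exists g : absGalQ, forall w, vertex (p w) n = g (vertex w n) >]].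

Lemma gal_permsP p : reflect
  (p \in tree_perms n /\ exists g : absGalQ, forall w, vertex (p w) n = g (vertex w n))
  (p \in gal_perms).
Proof. by rewrite [X in reflect _ X]inE; apply: (iffP andP) => -[pA /asboolP]. Qed.

Lemma gal_perms_group_set : group_set gal_perms.
Proof.
apply/group_setP; split=> [|p q].
  by apply/gal_permsP; split=> //; exists idfun => w; rewrite perm1.
move=> /gal_permsP[pA [g gp]] /gal_permsP[qA [h hq]]; apply/gal_permsP.
split; first exact: groupM.
by exists (h \o g) => w; rewrite permM hq gp.
Qed.

Canonical gal_perms_group := Group gal_perms_group_set.

(** A square root of [crit_diff i], built from the square roots that lead from level [i] to the
    next. *)
Definition theta (i : 'I_n) := \prod_(w in level n i) sqrtC (vertex w i - ratr c).

Lemma gal_theta (g : absGalQ) p (i : 'I_n) : p \in tree_perms n ->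
  (forall w j, (j <= n)%N -> vertex (p w) j = g (vertex w j)) ->
  g (theta i) = (-1) ^+ chi i p * theta i.
Proof.
move=> pA pg; rewrite /chi /theta rmorph_prod /=.
rewrite -[in RHS](big_level_perm _ i (fun w => sqrtC (vertex w i - ratr c)) pA).
rewrite -prod_signr -big_split; apply: eq_bigr => w wL /=.
rewrite -(vertex_agree (agree_trunc i _)) -vertexS pg // vertexS.
by rewrite (level_bit wL) // expr0 mul1r.
Qed.

(** The two children of the vertex of [w] are represented by [w] and by [w] with bit [i] flipped. *)
Lemma prod_level (i : 'I_n) (F : leaf n -> algC) :
  \prod_(w in level n i.+1) F w =
  \prod_(w in level n i) (F w * F (swap_fun i w w)).
Proof.
pose h w : leaf n := swap_fun i w w.
have hE w k : h w k = w k (+) (k == i) by rewrite ffunE agree_refl andbT.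
have hK : involutive h by move=> w; apply/ffunP => k; rewrite !hE addbK.
have levelS w : (w \in level n i.+1) && ~~ w i = (w \in level n i).
  apply/andP/idP => [[/levelP wS wi]|/levelP wL]; last first.
    by split; [apply/levelP => k /ltnW/wL | rewrite wL].
  apply/levelP => k; rewrite leq_eqVlt => /orP[/eqP/val_inj<-|/wS//].
  exact/negbTE.
have levelh w : (h w \in level n i.+1) = (w \in level n i.+1).
  apply/levelP/levelP => wL k ik; have := wL k ik; rewrite hE.
    by rewrite -val_eqE gtn_eqF // addbF.
  by rewrite -val_eqE gtn_eqF // addbF.
rewrite (bigID (fun w : leaf n => w i)) /= mulrC big_split /=; congr (_ * _).
  exact: eq_bigl.
rewrite (reindex_onto h h) => [|w _]; last exact: hK.
by apply: eq_bigl => w; rewrite hK eqxx andbT -levelS levelh hE eqxx addbT.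
Qed.

(** This is the product of [v - c] over the vertices [v] of level [i]. Rewriting it as [f^i(c) - a]
    costs one sign for each of the [2^i] vertices, which shows only for [i = 0]. *)
Definition crit_diff i : algC :=
  if i is 0 then ratr (a - c) else iter i quad (ratr c) - ratr a.

Lemma prod_sub_vertex i t : (i <= n)%N ->
  \prod_(w in level n i) (t - vertex w i) = iter i quad t - ratr a.
Proof.
elim: i t => [|i IHi] t ilt.
  rewrite (big_pred1 [ffun=> false]) // => w; rewrite inE.
  apply/eqP/eqP => [<-|->]; apply/ffunP => k; by rewrite !ffunE.
rewrite -[i]/(val (Ordinal ilt)) prod_level iterSr -IHi ?(ltnW ilt) //.
apply: eq_bigr => w wL; rewrite !vertexS.
rewrite -(vertex_agree (agree_swap (Ordinal ilt) w w)) ffunE eqxx agree_refl.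
rewrite (level_bit wL) //= expr0 expr1 mul1r mulN1r opprK -subr_sqr sqrtCK.
by rewrite /quad opprB addrA.
Qed.

Lemma theta_sqr (i : 'I_n) : theta i ^+ 2 = crit_diff i.
Proof.
rewrite /theta -prodrXl; under eq_bigr do rewrite sqrtCK.
case: i => -[|i] ilt /=.
  rewrite (big_pred1 [ffun=> false]) ?rmorphB // => w; rewrite inE.
  apply/eqP/eqP => [<-|->]; apply/ffunP => k; by rewrite !ffunE.
rewrite -[RHS](@prod_sub_vertex i.+1 _ (ltnW ilt)).
rewrite -[i]/(val (Ordinal (ltnW ilt))) !prod_level.
apply: eq_bigr => w _; rewrite -mulrNN !opprB //.
Qed.

Hypothesis crit_diff_indep : forall S : {set 'I_n}, S != set0 ->
  forall x : rat, ratr x ^+ 2 <> \prod_(i in S) crit_diff i.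

Lemma gal_perms_full : gal_perms :=: tree_perms n.
Proof.
apply: (@tree_perms_subgroup _ gal_perms_group).
  by apply/subsetP => p /gal_permsP[].
(* If no Galois element were odd on [S], the product [x] of the [theta i] would be Galois-fixed. But
   [x] squares to a rational and is itself irrational, so some automorphism negates it. *)
move=> S S0; apply: contrapT => Nex.
pose x := \prod_(i in S) theta i.
have xg (g : absGalQ) : g x = x.
  have [p pA pg] := gal_perm g.
  have pH : p \in gal_perms.
    by apply/gal_permsP; split=> //; exists g => w; rewrite pg.
  have -> : g x = (-1) ^+ (\big[addb/false]_(i in S) chi i p) * x.
    rewrite /x rmorph_prod -prod_signr -big_split.
    by apply: eq_bigr => i _; apply: gal_theta.
  case: (boolP (\big[addb/false]_(i in S) chi i p)) => [E|_].
    by case: Nex; exists p.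
  by rewrite expr0 mul1r.
have x2 : x ^+ 2 = \prod_(i in S) crit_diff i.
  by rewrite /x -prodrXl; apply: eq_bigr => i _; rewrite theta_sqr.
have d_rat i : crit_diff i \in Crat.
  have it k : iter k quad (ratr c) \in Crat.
    by elim: k => [|k IHk] /=; rewrite ?rpredD ?rpredX ?Crat_rat.
  by case: i => [|i]; rewrite /crit_diff ?rpredB ?Crat_rat.
have /CratP[d Dd] : \prod_(i in S) crit_diff i \in Crat by apply: rpred_prod.
have [/CratP[q xq]|xNQ] := boolP (x \in Crat).
  by apply: (crit_diff_indep S0 (x := q)); rewrite -xq x2.
have [g gx] := conj_sqrt_rat (etrans x2 Dd) xNQ.
have x0 : x = 0.
  apply/eqP; have: x *+ 2 == 0 by rewrite mulr2n -{1}(xg g) gx addNr.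
  by rewrite mulrn_eq0.
by move: xNQ; rewrite x0 rpred0.
Qed.

End Labelling.

(** * Compactness of the absolute Galois group *)

Lemma gal_orbit_finite (x : algC) : exists s : seq algC, forall g : absGalQ, g x \in s.
Proof.
have [r [Dr mon_r] dv_r] := minCpolyP x.
have [s Ds] := closed_field_poly_normal (minCpoly x).
exists s => g; have : root (minCpoly x) (g x).
  rewrite Dr (_ : map_poly ratr r = map_poly g (map_poly ratr r)).
    by rewrite fmorph_root dv_r.
  by rewrite -map_poly_comp; apply: eq_map_poly => q /=; rewrite fmorph_rat.
rewrite Ds rootZ ?root_prod_XsubC // lead_coef_eq0.
by rewrite Dr map_poly_eq0 monic_neq0.
Qed.

Section Compactness.
Local Open Scope classical_set_scope.

Lemma ultra_finite_range (I T : eqType) (U : set_system I) (F : I -> T) (s : seq T) :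
  UltraFilter U -> (forall i, F i \in s) -> exists y, U [set i | F i = y].
Proof.
move=> UU Fs; apply: contrapT => NU.
suff: U [set i | F i \notin s].
  by move=> /filter_ex[i /=]; rewrite Fs.
elim: s {Fs} => [|y s IHs]; first exact: filterE.
have [Uy|] := in_ultra_setVsetC [set i | F i = y] UU; first by case: NU; exists y.
move=> Uy; apply: filterS2 Uy IHs => i /= /eqP Fy Fs.
by rewrite inE negb_or Fy.
Qed.

(* A limit along an ultrafilter exists because Galois orbits are finite. *)
Lemma gal_limit (G : nat -> absGalQ) : exists g : absGalQ, forall x y,
  (exists N, forall n, (N <= n)%N -> G n x = y) -> g x = y.
Proof.
have [U [UU sU]] := ultraFilterLemma (eventually_filter : ProperFilter \oo).
have lim x : exists y, U [set n | G n x = y].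
  by have [s sP] := gal_orbit_finite x; apply: (@ultra_finite_range _ _ _ _ s).
pose l x := sval (cid (lim x)).
have lP x : U [set n | G n x = l x] by rewrite /l; case: cid.
(* Two sets of the ultrafilter meet, so the limit value is unique. *)
have lE x y : U [set n | G n x = y] -> l x = y.
  by move=> Uy; have [n [/= <- <-]] := filter_ex (filterI (lP x) Uy).
have lB : zmod_morphism l.
  move=> x y; apply: lE; apply: filterS2 (lP x) (lP y) => n /= <- <-.
  by rewrite rmorphB.
have lM : monoid_morphism l.
  split=> [|x y]; apply: lE; first by apply: filterE => n /=; rewrite rmorph1.
  by apply: filterS2 (lP x) (lP y) => n /= <- <-; rewrite rmorphM.
pose lBM := GRing.isZmodMorphism.Build _ _ l lB.
pose lMM := GRing.isMonoidMorphism.Build _ _ l lM.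
pose lRM : absGalQ := HB.pack l lBM lMM.
exists lRM => x y [N GN] /=; apply: lE; apply: sU.
by exists N => // n; apply: GN.
Qed.

End Compactness.

(** * Stoll's criterion *)

Section Surjectivity.

Variables a c : rat.

Local Notation f := ('X^2 + c%:P : {poly rat}).
Local Notation q := (quad c).

Hypothesis root_aperiodic : forall k, iter k.+1 q (ratr a) != ratr a.

Lemma fCE : fC f =1 q.
Proof. by move=> x; rewrite /fC /quad rmorphD /= map_polyXn map_polyC !hornerE. Qed.

Lemma vertexP x :
  reflect (exists n, iter n q x = ratr a) (x \in backward_orbit f a).
Proof.
have fq n : iter n (fC f) x = iter n q x by apply: eq_iter => y; rewrite fCE.
apply: (iffP idP) => [/set_mem[n xa]|[n xa]]; first by exists n; rewrite -fq.
by apply/mem_set; exists n; rewrite fq.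
Qed.

Lemma vertex_of n x : iter n q x = ratr a -> exists u : tree_vertex f a, val u = x.
Proof.
move=> xn; have xV : x \in backward_orbit f a by apply/vertexP; exists n.
by exists (exist (fun y => y \in backward_orbit f a) x xV).
Qed.

Lemma level_unique m n x :
  iter m q x = ratr a -> iter n q x = ratr a -> m = n.
Proof.
wlog mn : m n / (m <= n)%N.
  by move=> W xm xn; case/orP: (leq_total m n) => /W; [|move=> nm; symmetry]; auto.
move=> xm; rewrite -{1}(subnK mn) iterD xm; case: (n - m)%N (subnK mn) => // k _.
by move/eqP; rewrite (negbTE (root_aperiodic k)).
Qed.

(** Adjacency does not tell which end is the parent. Let [v] be the parent of [u]. If [sigma u] were
    the parent of [sigma v], then by induction and injectivity [u] would be the parent of [v], at
    the wrong level; if [v] is the root, the root would be periodic. *)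
Lemma tree_aut_quad (sigma : tree_aut f a) n (u : tree_vertex f a) :
  iter n q (val u) = ratr a ->
  iter n q (val (sigma u)) = ratr a /\
  ((0 < n)%N -> forall v : tree_vertex f a,
     val v = q (val u) -> val (sigma v) = q (val (sigma u))).
Proof.
elim: n u => [|n IHn] u un.
  have -> : u = tree_root f a by apply: val_inj.
  by rewrite raut_root.
have step : forall v : tree_vertex f a,
     val v = q (val u) -> val (sigma v) = q (val (sigma u)).
  move=> v vu; have vn : iter n q (val v) = ratr a by rewrite vu -iterSr.
  have [svn svq] := IHn _ vn.
  have: tree_adj (sigma u) (sigma v) by apply/raut_adj; left; rewrite fCE.
  case; rewrite fCE // => suv; exfalso.
  case: n {IHn} => [|n] in un vn svn svq *.
    have [m] := vertexP _ (valP (sigma u)); rewrite suv -iterSr.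
    rewrite (svn : val (sigma v) = _) => /eqP.
    by rewrite (negbTE (root_aperiodic m)).
  have [v' Dv'] : exists v' : tree_vertex f a, val v' = q (val v).
    by apply: (@vertex_of n); rewrite -iterSr.
  have /val_inj/(bij_inj (raut_bij sigma)) v'u : val (sigma v') = val (sigma u).
    by rewrite suv svq.
  have : iter n q (val u) = ratr a by rewrite -v'u Dv' -iterSr.
  by move/(level_unique un)/eqP; rewrite gtn_eqF.
split=> //; have [v Dv] : exists v : tree_vertex f a, val v = q (val u).
  by apply: (@vertex_of n); rewrite -iterSr.
have vn : iter n q (val v) = ratr a by rewrite Dv -iterSr.
by rewrite iterSr -(step v) //; case: (IHn _ vn).
Qed.

Hypothesis crit_diff_indep : forall n (S : {set 'I_n}), S != set0 ->
  forall x : rat, ratr x ^+ 2 <> \prod_(i in S) crit_diff a c i.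

(** Independence with a singleton [S] and [x = 0] shows that no [crit_diff] vanishes; so the
    critical value is not in the tree. *)
Lemma nodeNc b i : node a c b i != ratr c.
Proof.
apply/eqP => bc; have H := @crit_diff_indep i.+1 [set ord_max]%SET.
have ac : iter i q (ratr c) = ratr a.
  by rewrite -bc -[i in iter i]subn0 iter_quad_node.
apply: (H _ 0); first by apply/set0Pn; exists ord_max; rewrite inE.
rewrite (big_pred1 ord_max) => [|j]; last by rewrite inE.
rewrite rmorph0 expr0n /=; case: i {H} bc ac => [|i] _ ac /=.
  by rewrite rmorphB /= -ac subrr.
by rewrite -ac /= subrr.
Qed.

Lemma arboreal_surjective_level (sigma : tree_aut f a) n : exists g : absGalQ,
  forall i (u : tree_vertex f a), (i <= n)%N -> iter i q (val u) = ratr a ->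
  g (val u) = val (sigma u).
Proof.
(* [sigma] is extended to all of [algC] by the identity. *)
pose phi x := if pselect (x \in backward_orbit f a) is left xV
  then val (sigma (exist (fun y => y \in backward_orbit f a) x xV)) else x.
have phiE (u : tree_vertex f a) : phi (val u) = val (sigma u).
  rewrite /phi; case: pselect => [uV|]; last by case; apply: valP.
  by congr (val (sigma _)); apply: val_inj.
have inn b i : (i < n)%N -> node a c b i != ratr c by move=> _; apply: nodeNc.
have [|x y /vertex_of[u <-] /vertex_of[v <-]|w i ilt|p pA pphi] :=
  tree_map_perm (phi := phi) inn.
- by rewrite -[ratr a]/(val (tree_root f a)) phiE raut_root.
- by rewrite !phiE => /val_inj/(bij_inj (raut_bij sigma))->.
- have wi := iter_quad_vertex a c w ilt.
  have [u Du] := vertex_of wi.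
  have [v Dv] := @vertex_of i (q (vertex a c w i.+1)) (etrans (esym (iterSr _ _ _)) wi).
  rewrite -Dv -Du !phiE; apply: (proj2 (@tree_aut_quad sigma i.+1 u _)) => //.
    by rewrite Du.
  by rewrite Du Dv.
have := pA; rewrite -(gal_perms_full inn (@crit_diff_indep n)) => /gal_permsP[_ [g gp]].
exists g => i u ile ui; rewrite -phiE; have [w <-] := vertex_surj ile ui.
by rewrite -pphi // -!(iter_sub_vertex a c _ ile) -gal_iter_quad -gp.
Qed.

Theorem arboreal_surjective (sigma : tree_aut f a) :
  exists g : absGalQ, arboreal_rep f a g = sigma.
Proof.
have [G GP] := choice (arboreal_surjective_level sigma).
(* On a vertex of level [i], [G n] equals [sigma] for all [n >= i], so the limit does as well. *)
have [g gP] := gal_limit G; exists g; apply: rooted_autP => u; apply: val_inj => /=.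
have [i ui] := vertexP _ (valP u).
by apply: gP; exists i => n ile; apply: GP ile ui.
Qed.

End Surjectivity.

(** * Arithmetic of the critical orbit *)

Lemma coprime_mul_sqr m k x : coprime m k -> (m * k = x ^ 2)%N ->
  exists y, m = (y ^ 2)%N.
Proof.
move=> co_mk mkx; have [m0|m_gt0] := posnP m; first by exists 0%N.
(* The root is [g]: with [m = m' g], coprimality gives that [m'] and [g] divide each other. *)
set g := gcdn m x; have g_gt0 : (0 < g)%N by rewrite gcdn_gt0 m_gt0.
have /dvdnP[m' Dm] : (g %| m)%N := dvdn_gcdl m x.
have /dvdnP[x' Dx] : (g %| x)%N := dvdn_gcdr m x.
have co_m'x' : coprime m' x'.
  rewrite /coprime -(eqn_pmul2r g_gt0) mul1n muln_gcdl -Dm -Dx; exact/eqP.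
have E : (m' * k = g * x' ^ 2)%N.
  apply/eqP; rewrite -(eqn_pmul2r g_gt0); apply/eqP; nia.
exists g; rewrite Dm -mulnn; congr (_ * _)%N; apply/eqP; rewrite eqn_dvd.
apply/andP; split.
  rewrite -(@Gauss_dvdl m' g (x' ^ 2)) ?coprimeXr // -E dvdn_mulr //.
rewrite -(@Gauss_dvdl g m' k) ?E ?dvdn_mulr //.
exact: coprime_dvdl (dvdn_gcdl m x) co_mk.
Qed.

(** [x * Q] is rational with integral square, hence an integer. *)
Lemma sqr_rat_int (x : rat) (M Q : int) : Q != 0 ->
  x ^+ 2 * (Q ^+ 2)%:~R = M%:~R -> exists y : nat, (`|M| = y ^ 2)%N.
Proof.
move=> Q0 xQM.
have D0 : (denq x)%:~R != 0 :> rat by rewrite intr_eq0 denq_neq0.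
have E : (numq x * Q) ^+ 2 = M * denq x ^+ 2.
  have xD : x * (denq x)%:~R = (numq x)%:~R by rewrite -{1}(divq_num_den x) mulfVK.
  apply: (@intr_inj rat); rewrite !expr2 !intrM -xQM !expr2 intrM -xD; ring.
have En : ((`|numq x| * `|Q|) ^ 2 = `|M| * `|denq x| ^ 2)%N.
  by have := congr1 absz E; rewrite !expr2 !abszM -!mulnn.
have Dn0 : (0 < `|denq x|)%N by rewrite absz_gt0 denq_neq0.
have : (`|denq x| %| `|numq x| * `|Q|)%N.
  by rewrite -(@dvdn_pexp2r _ _ 2) // En dvdn_mull.
case/dvdnP => y Ey; exists y; apply/eqP.
by rewrite -(@eqn_pmul2r (`|denq x| ^ 2)) ?expn_gt0 ?Dn0 // -En Ey expnMn.
Qed.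

Section CriticalOrbit.

Variables r s : int.

(* [kpow n = s ^ (2 ^ n.+1 - 2)], so that the [n.+1]-st point of the critical  *)
(* orbit is [orb n / (s ^ 2 * kpow n)].                                        *)
Fixpoint kpow n : int := if n is m.+1 then (kpow m * s) ^+ 2 else 1.

Definition cnum : int := - (r * (r + s)).

Fixpoint orb n : int := if n is m.+1 then orb m ^+ 2 + cnum * kpow n else cnum.

Lemma orbS n : orb n.+1 = orb n ^+ 2 + cnum * kpow n.+1.
Proof. by []. Qed.

(* The numerator of [f^(n+1)(0) - a]. *)
Definition dnum n : int := orb n - r * s * kpow n.

(* Iterates [f x + a = (x - a) * (x + a)], which holds because [f a = - a]. *)
Lemma orb_prod n : orb n + r * s * kpow n = - r ^+ 2 * \prod_(j < n) dnum j.
Proof.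
elim: n => [|n IHn]; first by rewrite big_ord0 /= /cnum; ring.
by rewrite big_ord_recr /= [RHS]mulrA -IHn /dnum /cnum; ring.
Qed.

Lemma kpow_neq0 n : s != 0 -> kpow n != 0.
Proof. by move=> s0; elim: n => //= n IHn; rewrite expf_eq0 mulf_eq0 negb_or IHn. Qed.

Lemma coprimez_kpow n x : coprimez x s -> coprimez x (kpow n).
Proof.
move=> xs; elim: n => [|n IHn] /=; first by rewrite /coprimez gcdz1.
by rewrite coprimez_pexpr // coprimezMr IHn.
Qed.

Section Coprimality.

(* [u] and [t] stand for [2 ^ e] and [2 ^ (1 - e)] with [e] as in [eps]; this   *)
(* makes the cofactors [wnum n] coprime even at 2.                             *)
Variables u t r' : int.
Hypotheses (ut : u * t = 2) (Dr : r = u * r').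
Hypotheses (co_r' : coprimez r' (t * s)) (co_u : coprimez u (t * s)).

(** The cofactor [2 + a \prod_(0 < j < n) (f^j(0) - a)], up to the shift of index, with denominators
    cleared and [u] divided out. *)
Definition wnum n : int := r' * \prod_(j < n) dnum j + t * s * kpow n.

Lemma dnumE n : dnum n = - (u * r * wnum n).
Proof.
have -> : dnum n = orb n + r * s * kpow n - 2 * (r * s * kpow n).
  by rewrite /dnum; ring.
by rewrite orb_prod -ut /wnum Dr; ring.
Qed.

(** Modulo [t * s] only the product survives, and by induction its factors are units there. *)
Lemma coprimez_wnum_ts n : coprimez (wnum n) (t * s).
Proof.
elim/ltn_ind: n => n IHn; rewrite coprimez_sym /coprimez /wnum addrC.
rewrite [t * s * kpow n]mulrC.
rewrite gcdzMDl -[_ == _]/(coprimez _ _) coprimezMr coprimez_sym co_r' /=.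
elim/big_ind: _ => [|x y xt yt|j _]; first by rewrite /coprimez gcdz1.
  by rewrite coprimezMr xt.
rewrite dnumE Dr coprimezN !coprimezMr.
by rewrite !(coprimez_sym (t * s)) co_u co_r' IHn.
Qed.

Lemma coprimez_wnum_r n : coprimez (wnum n) r'.
Proof.
rewrite coprimez_sym /coprimez /wnum mulrC gcdzMDl -[_ == _]/(coprimez _ _).
rewrite coprimezMr co_r' coprimez_kpow //.
by move: co_r'; rewrite coprimezMr => /andP[].
Qed.

(** [wnum j] divides [dnum j], hence the first summand of [wnum n], and is prime to the second. *)
Lemma coprimez_wnum j n : (j < n)%N -> coprimez (wnum j) (wnum n).
Proof.
move=> jn; have co := coprimez_wnum_ts j.
rewrite {2}/wnum (bigD1 (Ordinal jn)) //= dnumE.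
set P := \prod_(_ < _ | _) _.
rewrite /coprimez (_ : r' * _ = - (r' * (u * r) * P) * wnum j); last by ring.
rewrite gcdzMDl -[_ == _]/(coprimez _ _) coprimezMr co coprimez_kpow //.
by move: co; rewrite coprimezMr => /andP[].
Qed.

Lemma wnum_sqr n (S : {set 'I_n}) (i : 'I_n) (X : nat) : i \in S -> u != 0 ->
  (`|(\prod_(j in S) dnum j)%R| = X ^ 2)%N -> exists y : nat, (`|wnum i| = y ^ 2)%N.
Proof.
move=> iS u0; set k := #|S|.
(* As [dnum j] is [- u ^+ 2 * r' * wnum j], the product is a square times [wnum i] times a factor
   coprime to [wnum i]. *)
have -> : \prod_(j in S) dnum j =
    (u ^+ k) ^+ 2 * (wnum i * ((- r') ^+ k * \prod_(j in S | j != i) wnum j)).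
  rewrite (eq_bigr (fun j : 'I_n => (u ^+ 2 * - r') * wnum j)) => [|j _]; last first.
    by rewrite dnumE Dr; ring.
  rewrite big_split prodr_const (bigD1 i iS) /= -/k exprMn exprAC.
  move: (u ^+ k) ((- r') ^+ k) => x y; ring.
rewrite !abszM !abszX => E.
have uk0 : (0 < `|u| ^ k)%N by rewrite expn_gt0 absz_gt0 u0.
have /dvdnP[x' Dx] : (`|u| ^ k %| X)%N.
  by rewrite -(@dvdn_pexp2r _ _ 2) // -E dvdn_mulr.
apply: (@coprime_mul_sqr _ (`|((- r') ^+ k * \prod_(j in S | j != i) wnum j)%R|)%N x').
  rewrite -[coprime _ _]/(coprimez _ _) coprimezMr; apply/andP; split.
    by apply: coprimezXr; rewrite coprimezN coprimez_wnum_r.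
  elim/big_ind: _ => [|x y xt yt|j /andP[_ ji]]; first by rewrite /coprimez gcdz1.
    by rewrite coprimezMr xt.
  by case: (ltngtP i j) ji => [/coprimez_wnum//|/coprimez_wnum|/val_inj->];
    rewrite ?eqxx // coprimez_sym.
have uk2 : (0 < (`|u| ^ k) ^ 2)%N by rewrite expn_gt0 uk0.
apply/eqP; rewrite -(eqn_pmul2l uk2).
by rewrite abszM abszX E Dx expnMn mulnC.
Qed.

End Coprimality.

(** * Residues of the numerators modulo divisors of [s], 3 and 4 *)

Lemma coprimez_orb n : coprimez r s -> coprimez s (orb n).
Proof.
move=> rs; elim: n => [|n IHn] /=.
  rewrite /cnum coprimezN coprimezMr coprimez_sym rs /=.
  by rewrite /coprimez gcdzDr -[_ == _]/(coprimez _ _) coprimez_sym.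
rewrite /coprimez (_ : _ + _ = (cnum * kpow n ^+ 2 * s) * s + orb n ^+ 2); last by ring.
by rewrite gcdzMDl -[_ == _]/(coprimez _ _) coprimez_pexpr.
Qed.

(* Modulo [s], [dnum n.+1] is the square of the unit [orb n]. *)
Lemma dnum_quad_residue n (q m y : int) : coprimez r s -> (q %| s)%Z ->
  dnum n.+1 = m * y ^+ 2 -> quad_residue q m.
Proof.
move=> rs /dvdzP[s' Ds] E.
have co_q : coprimez q (orb n).
  by have := coprimez_orb n rs; rewrite {1}Ds coprimezMl => /andP[].
pose k := r * s' * kpow n.+1 - cnum * kpow n ^+ 2 * s * s'.
have Ek : orb n ^+ 2 = k * q + m * y ^+ 2.
  have -> : k * q = (r * kpow n.+1 - cnum * kpow n ^+ 2 * s) * (s' * q).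
    by rewrite /k; ring.
  by rewrite -Ds -E /dnum /=; ring.
have co_y : coprimez y q.
  rewrite coprimez_sym; have: coprimez q (orb n ^+ 2) by rewrite coprimez_pexpr.
  rewrite Ek /coprimez gcdzMDl -[_ == _]/(coprimez _ _) coprimezMr coprimez_pexpr //.
  by case/andP.
(* [v2] inverts [y] modulo [q], so [orb n * v2] is a square root of [m]. *)
have [[v2 v1] /= v12] := coprimezP _ _ co_y.
exists (orb n * v2); apply/eqP; rewrite eqz_mod_dvd exprMn Ek; apply/dvdzP.
exists (m * (v1 ^+ 2 * q - 2 * v1) + k * v2 ^+ 2).
transitivity (m * ((v2 * y) ^+ 2 - 1) + k * v2 ^+ 2 * q); first by ring.
by rewrite (_ : v2 * y = 1 - v1 * q); [ring | rewrite -v12; ring].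
Qed.

Lemma kpow_mod3 n : (exists x, s = 3 * x + 1) \/ (exists x, s = 3 * x + 2) ->
  exists x, kpow n = 3 * x + 1.
Proof.
move=> s3; elim: n => [|n [x IHn]] /=; first by exists 0.
rewrite IHn; case: s3 => -[z ->].
  by exists (3 * (3 * x * z + x + z) ^+ 2 + 2 * (3 * x * z + x + z)); ring.
by exists (3 * (3 * x * z + 2 * x + z) ^+ 2 + 4 * (3 * x * z + 2 * x + z) + 1); ring.
Qed.

(** Modulo 3, [cnum = -(1 + r s)] and [kpow n = 1], so the recursion reproduces
    [orb n.+1 = 1 + r s]; subtracting [r s] leaves 1. *)
Lemma dnum_mod3 n : ~~ (3 %| r)%Z -> ~~ (3 %| s)%Z -> exists x, dnum n.+1 = 3 * x + 1.
Proof.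
have mod3 x : ~~ (3 %| x)%Z -> (exists y, x = 3 * y + 1) \/ (exists y, x = 3 * y + 2).
  move=> x3; have : (x %% 3)%Z = 1 \/ (x %% 3)%Z = 2 by lia.
  by case=> E; [left | right]; exists (x %/ 3)%Z; lia.
move=> /mod3 r3 /mod3 s3.
have sqr3 (x : int) : (exists y, x = 3 * y + 1) \/ (exists y, x = 3 * y + 2) ->
    exists k, x ^+ 2 = 3 * k + 1.
  case=> -[y ->]; first by exists (3 * y ^+ 2 + 2 * y); ring.
  by exists (3 * y ^+ 2 + 4 * y + 1); ring.
have [[k Dk] [l Dl]] := (sqr3 _ r3, sqr3 _ s3).
have [h Dh] : exists h, (r * s) ^+ 2 = 3 * h + 1.
  by exists (3 * k * l + k + l); rewrite exprMn Dk Dl; ring.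
have Dc : cnum = - r ^+ 2 - r * s by rewrite /cnum; ring.
have [x Dx] : exists x, orb n.+1 = 3 * x + 1 + r * s.
  elim: n => [|n [x IHn]].
    have [j Dj] := kpow_mod3 1 s3; rewrite orbS Dj /=.
    exists (3 * k ^+ 2 + 2 * k * (1 + r * s) + h - k
      + (- 3 * k - 1 - r * s) * j).
    rewrite Dc Dk; apply/eqP; rewrite -subr_eq0; apply/eqP.
    transitivity ((r * s) ^+ 2 - (3 * h + 1)); first by ring.
    by rewrite Dh subrr.
  have [j Dj] := kpow_mod3 n.+2 s3.
  rewrite orbS IHn Dj.
  exists (3 * x ^+ 2 + 2 * x * (1 + r * s) + h - k
      + (- 3 * k - 1 - r * s) * j).
  rewrite Dc Dk; apply/eqP; rewrite -subr_eq0; apply/eqP.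
  transitivity ((r * s) ^+ 2 - (3 * h + 1)); first by ring.
  by rewrite Dh subrr.
have [j Dj] := kpow_mod3 n.+1 s3.
by exists (x - r * s * j); rewrite /dnum Dx Dj; ring.
Qed.

(** For even [s], [orb n] is odd and 4 divides [kpow n.+1]. For odd [s], [orb n] is even,
    [kpow n.+1 = 1] modulo 4, and [- r^2 - 2 r s = 1] remains. *)
Lemma dnum_mod4 n : ~~ (2 %| r)%Z -> exists x, dnum n.+1 = 4 * x + 1.
Proof.
have mod2 x : ~~ (2 %| x)%Z -> exists y, x = 2 * y + 1.
  by move=> x2; exists (x %/ 2)%Z; lia.
move=> /mod2[r1 Dr].
have [s2|/mod2[s1 Ds]] := boolP (2 %| s)%Z.
  have /dvdzP[s1 Ds] := s2.
  have [x Dx] : exists x, orb n = 2 * x + 1.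
    elim: n => [|n [x IHn]] /=.
      exists (- (2 * r1 ^+ 2 + 2 * r1 + r * s1) - 1).
      by rewrite /cnum Ds Dr; ring.
    exists (2 * x ^+ 2 + 2 * x + 2 * cnum * kpow n ^+ 2 * s1 ^+ 2).
    by rewrite IHn Ds; ring.
  exists (x ^+ 2 + x + (cnum - r * s) * (kpow n * s1) ^+ 2).
  by rewrite /dnum orbS Dx /= Ds; ring.
have [k Dk] : exists k, kpow n.+1 = 4 * k + 1.
  have [y Dy] : exists y, kpow n = 2 * y + 1.
    elim: n => [|n [y IHn]] /=; first by exists 0.
    exists (2 * (2 * y * s1 + y + s1) ^+ 2 + 2 * (2 * y * s1 + y + s1)).
    by rewrite IHn Ds; ring.
  exists ((2 * y * s1 + y + s1) ^+ 2 + (2 * y * s1 + y + s1)).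
  by rewrite /= Dy Ds; ring.
pose c1 := - ((2 * r1 + 1) * (r1 + s1 + 1)).
have Dc : cnum = 2 * c1 by rewrite /cnum /c1 Dr Ds; ring.
have [x Dx] : exists x, orb n = 2 * x.
  elim: n {k Dk} => [|n [x IHn]] /=; first by exists c1.
  by exists (2 * x ^+ 2 + c1 * (kpow n * s) ^+ 2); rewrite IHn Dc; ring.
exists (x ^+ 2 + 2 * c1 * k - r * s * k - (r1 ^+ 2 + 2 * r1 + 2 * r1 * s1 + s1 + 1)).
by rewrite /dnum orbS Dk Dx Dc /c1 Dr Ds; ring.
Qed.

End CriticalOrbit.

(** * Real dynamics of the critical orbit *)

Lemma beta_cubic : beta ^+ 3 + 2 * beta ^+ 2 = 2.
Proof.
pose w : algC := sqrtC 33; have w2 : w ^+ 2 = 33 by apply: sqrtCK.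
have w_ge0 : 0 <= w by rewrite sqrtC_ge0.
pose x := 3.-root (19 - 3 * w); pose y := 3.-root (19 + 3 * w).
have x3 : x ^+ 3 = 19 - 3 * w by rewrite rootCK.
have y3 : y ^+ 3 = 19 + 3 * w by rewrite rootCK.
(* Cardano's formula: the radicands multiply to [361 - 9 * 33 = 4 ^ 3]. *)
have yx : y * x = 4.
  rewrite -rootCMl; last by rewrite addr_ge0 ?mulr_ge0.
  have -> : (19 + 3 * w) * (19 - 3 * w) = 4 ^+ 3.
    have -> : (19 + 3 * w) * (19 - 3 * w) = 361 - 9 * w ^+ 2 by ring.
    by rewrite w2; ring.
  by rewrite exprCK.
have b : 3 * beta = - 2 + x + y by rewrite /beta mulrA divff ?mul1r ?pnatr_eq0.
have b3 : 27 * (beta ^+ 3 + 2 * beta ^+ 2) = 27 * 2.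
  transitivity ((3 * beta) ^+ 3 + 6 * (3 * beta) ^+ 2); first by ring.
  rewrite b; transitivity (x ^+ 3 + y ^+ 3 + 3 * (x + y) * (y * x - 4) + 16).
    by ring.
  by rewrite x3 y3 yx; ring.
by apply: (mulfI _ b3); rewrite pnatr_eq0.
Qed.

(** For [a > 0] the conclusion means [f(c) < a], as [f(c) - a = a (a^3 + 2 a^2 - 2)]. *)
Lemma range1_cubic a : range1 a -> a ^+ 3 + 2 * a ^+ 2 < 2.
Proof.
case/andP => a0 ab; rewrite -(ltr_rat algC) rmorphD rmorphM !rmorphXn /=.
have a0C : 0 < ratr a :> algC by rewrite ltr0q.
have -> : ratr 2 = 2 :> algC by rewrite ratr_nat.
rewrite -[ltRHS]beta_cubic; apply: ltrD; first by rewrite ltrXn2r // ltW.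
by rewrite ltr_pM2l // ltrXn2r // ltW.
Qed.

Definition ratquad (c x : rat) := x ^+ 2 + c.

(** The interval [[c, a]] is invariant: on it [|x| <= |c|], whence [c <= f(x) <= f(c) < a]. *)
Lemma crit_orbit_le a n : range1 a ->
  iter n.+1 (ratquad (- a - a ^+ 2)) (- a - a ^+ 2) <= a.
Proof.
move=> ra; have := range1_cubic ra; case/andP: ra => a0 _ a3.
set c := - a - a ^+ 2; have ca : c + a <= 0 by rewrite /c; nra.
have c2 : c ^+ 2 + c < a.
  have : a * (a ^+ 3 + 2 * a ^+ 2 - 2) < 0 by rewrite pmulr_rlt0 // subr_lt0.
  by rewrite /c; lra.
suff H m : c <= iter m (ratquad c) c <= a by case/andP: (H n.+1).
elim: m => [|m /andP[mc ma]] /=; first by apply/andP; split; lra.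
move: (iter m _ _) mc ma => x xc xa; rewrite /ratquad.
by apply/andP; split; nra.
Qed.

(** The fixed points of [f] are [- a] and [1 + a]. The orbit is trapped in [[- a, oo)] for [a < -2],
    in [[a, - a]] for [-2 < a < -1], and in [[1 + a, oo)] for [a > 1]; for [-1 < a < 0], [c] is
    nonnegative. The first point [c] is excluded: it lies below [a] in the two outer cases. *)
Lemma crit_orbit_ge a n : range0 a ->
  a <= iter n.+1 (ratquad (- a - a ^+ 2)) (- a - a ^+ 2).
Proof.
set c := - a - a ^+ 2; case/or4P=> [a2|/andP[a2 a1]|/andP[a1 a0]|a1].
- have ca : c <= a by rewrite /c; nra.
  suff: - a <= iter n.+1 (ratquad c) c by lra.
  elim: n => [|n /=]; first by rewrite /= /ratquad; rewrite /c in ca *; nra.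
  by move: (ratquad c _) => x xa; rewrite /ratquad /c; nra.
- have ca : a <= c by rewrite /c; nra.
  suff H m : a <= iter m (ratquad c) c <= - a by case/andP: (H n.+1).
  elim: m => [|m /andP[mc ma]] /=; first by apply/andP; split; rewrite // /c; nra.
  move: (iter m _ _) mc ma => x xc xa; rewrite /ratquad.
  by apply/andP; split; rewrite /c in ca *; nra.
- have ca : 0 <= c by rewrite /c; nra.
  by rewrite /= /ratquad; have := sqr_ge0 (iter n (ratquad c) c); rewrite /ratquad; lra.
- have ca : c <= - (1 + a) by rewrite /c; nra.
  suff: 1 + a <= iter n.+1 (ratquad c) c by lra.
  elim: n => [|n /=].
    have : (1 + a) ^+ 2 <= c ^+ 2 by nra.
    by rewrite /= /ratquad /c; lra.
  by move: (ratquad c _) => x xa; rewrite /ratquad /c; nra.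
Qed.

Lemma iter_quad_ratr c n x :
  iter n (quad c) (ratr x) = ratr (iter n (ratquad c) x).
Proof. by elim: n => //= n ->; rewrite /quad rmorphD rmorphXn. Qed.

(** * Square classes of the critical differences *)

Section RationalBase.

Variables (a : rat) (r s : int).
Hypotheses (Da : a = r%:~R / s%:~R) (s_gt0 : 0 < s) (co_rs : coprimez r s).

Local Notation c := (- a - a ^+ 2).

Definition rat_diff n : rat :=
  if n is 0 then a - c else iter n (ratquad c) c - a.

Lemma crit_diffE n : crit_diff a c n = ratr (rat_diff n).
Proof. by case: n => [|n]; rewrite // /crit_diff iter_quad_ratr rmorphB. Qed.

Lemma s_neq0 : s != 0. Proof. by rewrite gt_eqF. Qed.

Lemma orbE n : iter n (ratquad c) c = (orb r s n)%:~R / (s ^+ 2 * kpow s n)%:~R.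
Proof.
have s0 : s%:~R != 0 :> rat by rewrite intr_eq0 s_neq0.
elim: n => [|n IHn].
  rewrite /= /cnum Da mulr1 !expr2 !(intrN, intrM, intrD); field.
  exact: s0.
have k0 : (kpow s n)%:~R != 0 :> rat by rewrite intr_eq0 kpow_neq0 // s_neq0.
rewrite iterS IHn orbS /= /ratquad /cnum Da.
rewrite !expr2 !(intrN, intrM, intrD).
by field; rewrite s0 k0.
Qed.

(** The sign at index 0 arises because [rat_diff 0] is [a - c], while [dnum 0] is the numerator of
    [c - a]. *)
Lemma rat_diffE n : rat_diff n * (s ^+ 2 * kpow s n)%:~R =
  ((if n is 0 then -1 else 1) * dnum r s n)%:~R.
Proof.
have s0 : s%:~R != 0 :> rat by rewrite intr_eq0 s_neq0.
have k0 : (s ^+ 2 * kpow s n)%:~R != 0 :> rat.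
  by rewrite intr_eq0 mulf_neq0 ?expf_neq0 ?kpow_neq0 ?s_neq0.
have E : (iter n (ratquad c) c - a) * (s ^+ 2 * kpow s n)%:~R = (dnum r s n)%:~R.
  rewrite mulrBl orbE divfK // /dnum intrB; congr (_ - _).
  by rewrite Da !expr2 !intrM; field; exact: s0.
case: n k0 E => [|n] _ E; last by rewrite mul1r -E.
by rewrite mulN1r intrN -E /=; ring.
Qed.

Lemma numq_denq : numq a = r /\ denq a = s.
Proof.
have co : coprime `|r| `|s| by [].
by rewrite Da coprimeq_num // coprimeq_den // gtr0_sg // mul1r gt_eqF // gtr0_norm.
Qed.

Lemma epsE : a != 0 -> eps a = (2 %| r)%Z.
Proof.
move=> a0; have [Nr Ds] := numq_denq; rewrite /eps /Defs.valq Nr Ds.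
have r0 : (0 < `|r|)%N by rewrite absz_gt0 -Nr numq_eq0.
have s0 : (0 < `|s|)%N by rewrite absz_gt0 s_neq0.
have [r2|r2] := boolP (2 %| r)%Z.
  have s2 : ~~ (2 %| `|s|)%N.
    apply: contraL co_rs => s2; rewrite /coprimez /gcdz; apply: contraTneq r2.
    move=> [g1]; apply/negP => r2.
    by have : (2 %| gcdn `|r| `|s|)%N; [rewrite dvdn_gcd s2 andbT | rewrite g1].
  have l1 : (0 < logn 2 `|r|)%N by rewrite logn_gt0 mem_primes r0.
  by rewrite (lognE 2 `|s|) s0 (negbTE s2) /= subr0 ltz_nat l1.
by rewrite (lognE 2 `|r|) r0 -[(2 %| `|r|)%N]/((2 %| r)%Z) (negbTE r2) /= sub0r oppr_gt0.
Qed.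

Lemma dnum_sign n : range0 a || range1 a ->
  dnum r s n.+1 = (-1) ^+ delta a * `|dnum r s n.+1|.
Proof.
move=> ra; have K : 0 < (s ^+ 2 * kpow s n.+1)%:~R :> rat.
  have k0 := kpow_neq0 n.+1 s_neq0.
  by rewrite ltr0z lt0r mulf_eq0 negb_or k0 sqrf_eq0 s_neq0 mulr_ge0 ?sqr_ge0.
have := rat_diffE n.+1; rewrite mul1r => E; rewrite /delta.
case: ifP ra => [r1 _|_]; last rewrite orbF => r0.
  rewrite expr1 mulN1r ler0_norm ?opprK // -(lerz0 rat) -E.
  by rewrite pmulr_lle0 // subr_le0 crit_orbit_le.
rewrite expr0 mul1r ger0_norm // -(ler0z rat) -E.
by rewrite pmulr_lge0 // subr_ge0 crit_orbit_ge.
Qed.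

Local Notation m := ((-1) ^+ delta a * 2 ^+ eps a * `|r| : int).

Lemma dnum_eq_sqr n (S : {set 'I_n}) (i : 'I_n) (x : rat) :
  range0 a || range1 a -> a != 0 -> i \in S -> (0 < i)%N ->
  x ^+ 2 = \prod_(j in S) rat_diff j -> exists y : int, dnum r s i = m * y ^+ 2.
Proof.
move=> ra a0 iS i_gt0 x2.
(* [s * k j] is a square root of the denominator [s ^+ 2 * kpow s j]. *)
pose k j : int := if j is l.+1 then kpow s l * s else 1.
have kE j : kpow s j = k j ^+ 2 by case: j.
have k0 j : s * k j != 0.
  by rewrite mulf_neq0 ?s_neq0 //; case: j => //= j; rewrite mulf_neq0 ?kpow_neq0 ?s_neq0.
pose Q : int := \prod_(j in S) (s * k j).
pose sg (j : nat) : int := if j is 0 then -1 else 1.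
have sg1 j : `|sg j|%N = 1%N by case: j.
have Q0 : Q != 0 by apply/prodf_neq0 => j _.
have [X DX] : exists X : nat, (`|(\prod_(j in S) (sg j * dnum r s j))%R| = X ^ 2)%N.
  apply: (@sqr_rat_int x _ Q Q0); rewrite x2 /Q -prodrXl !rmorph_prod /= -big_split /=.
  by apply: eq_bigr => j _; rewrite exprMn -kE rat_diffE.
have sgS : `|(\prod_(j in S) sg j)%R|%N = 1%N.
  by elim/big_ind: _ => // u v Du Dv; rewrite abszM Du Dv.
rewrite big_split abszM sgS mul1n /= in DX.
(* For even [r], [s] is odd and [u = 2], [t = 1]; for odd [r], [u = 1], [t = 2]. *)
have [u [t [r' [Du ut Dr co_r' co_u]]]] : exists u t r' : int,
    [/\ u = 2 ^+ eps a, u * t = 2, r = u * r', coprimez r' (t * s) & coprimez u (t * s)].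
  rewrite epsE //; have [/dvdzP[r' Dr]|r2] := boolP (2 %| r)%Z.
    exists 2, 1, r'; have := co_rs; rewrite Dr coprimezMl => /andP[co1 co2].
    by split; rewrite ?mul1r // mulrC.
  exists 1, 2, r; split; rewrite ?mul1r // coprimezMr ?co_rs ?andbT; last first.
    by rewrite /coprimez !gcd1z.
  by rewrite coprimez_sym -[coprimez _ _]/(coprime 2 `|r|) prime_coprime.
have u0 : u != 0 by rewrite Du expf_neq0.
have [y Dy] := wnum_sqr ut Dr co_r' co_u iS u0 DX.
case: {iS} (nat_of_ord i) i_gt0 Dy => // j _ Dy; exists y%:Z.
have Dw : `|wnum r s t r' j.+1| = y%:Z ^+ 2 by rewrite -abszE Dy -mulnn PoszM.
rewrite dnum_sign // (dnumE s ut Dr) normrN !normrM Dw -Du ger0_norm; first by ring.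
by rewrite Du exprn_ge0.
Qed.

Lemma rat_diff_indep n (S : {set 'I_n}) (x : rat) :
  range0 a || range1 a -> a != 0 ->
  ~ (exists y : rat, y ^+ 2 = a - c) ->
  [\/ (m = 2 %[mod 3])%Z,
      (m = 3 %[mod 4])%Z
    | exists q : nat, [/\ prime q, (q%:Z %| s)%Z & ~ quad_residue q%:Z m]] ->
  S != set0 -> x ^+ 2 <> \prod_(j in S) rat_diff j.
Proof.
move=> ra a0 nsq mcond S0 x2.
have [/existsP[i /andP[iS i_gt0]]|] := boolP [exists i : 'I_n, (i \in S) && (0 < i)%N].
  have [y] := dnum_eq_sqr ra a0 iS i_gt0 x2.
  case: {iS} (nat_of_ord i) i_gt0 => // j _ Dy.
  case: mcond => [m2|m3|[q [_ qs]]]; last by apply; apply: dnum_quad_residue Dy.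
    have /dvdzP[k Dk] : (3 %| m - 2)%Z by rewrite -eqz_mod_dvd; apply/eqP.
    (* If 3 divides [s], then 2 would be a square modulo 3. Otherwise [dnum] is 1 modulo 3, while
       [m y^2] is 0 or 2. *)
    have [s3|s3] := boolP (3 %| s)%Z.
      have [z /eqP] := dnum_quad_residue co_rs s3 Dy.
      rewrite eqz_mod_dvd => /dvdzP[l Dl].
      move: (m) Dk Dl => M Dk Dl.
      have : (z %% 3)%Z \in [:: 0; 1; 2 : int] by rewrite !inE; lia.
      have := divz_eq z 3; move: (z %/ 3)%Z (z %% 3)%Z => z1 z2 Dz.
      by rewrite !inE => /or3P[]/eqP Ez; subst z2 z; nia.
    have r3 : ~~ (3 %| r)%Z.
      apply/negP => r3; have /dvdzP[l Dl] : (3 %| m)%Z.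
        by rewrite dvdz_mull // dvdzE -abszE absz_nat.
      by move: (m) Dk Dl => M; lia.
    have [l Dl] := dnum_mod3 j r3 s3.
    move: (m) Dk Dy => M Dk; rewrite Dl.
    have : (y %% 3)%Z \in [:: 0; 1; 2 : int] by rewrite !inE; lia.
    have := divz_eq y 3; move: (y %/ 3)%Z (y %% 3)%Z => z1 z2 Dz.
    by rewrite !inE => /or3P[]/eqP Ez; subst z2 y; nia.
  (* Here [r] is odd, so [dnum] is 1 modulo 4, while [m y^2] is 0 or 3. *)
  have /dvdzP[k Dk] : (4 %| m - 3)%Z by rewrite -eqz_mod_dvd; apply/eqP.
  have r2 : ~~ (2 %| r)%Z.
    apply/negP => r2; have /dvdzP[l Dl] : (2 %| m)%Z.
      by rewrite dvdz_mull // dvdzE -abszE absz_nat.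
    by move: (m) Dk Dl => M; lia.
  have [l Dl] := dnum_mod4 s j r2.
  move: (m) Dk Dy => M Dk; rewrite Dl.
  have : (y %% 2)%Z \in [:: 0; 1 : int] by rewrite !inE; lia.
  have := divz_eq y 2; move: (y %/ 2)%Z (y %% 2)%Z => z1 z2 Dz.
  by rewrite !inE => /orP[]/eqP Ez; subst z2 y; nia.
(* Now [S] contains only the index 0, and [x] is a square root of [a - c]. *)
rewrite negb_exists => /forallP S_le0.
have [i iS] := set0Pn _ S0.
have Si j : (j \in S) = (j == i).
  have S_0 l : l \in S -> l = 0%N :> nat.
    by move=> lS; have := S_le0 l; rewrite lS /= lt0n negbK => /eqP.
  apply/idP/eqP => [jS|->//]; apply: val_inj.
  exact: etrans (S_0 _ jS) (esym (S_0 _ iS)).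
have i0 : nat_of_ord i = 0%N.
  by have := S_le0 i; rewrite iS /= lt0n negbK => /eqP.
by apply: nsq; exists x; rewrite x2 (big_pred1 i) // i0.
Qed.

End RationalBase.

Theorem theorem1p1 (a : rat) (r s : int) :
  let c : rat := - a - a ^+ 2 in
  let f : {poly rat} := 'X^2 + c%:P in
  let m : int := (-1) ^+ delta a * 2 ^+ eps a * `|r| in
  a = r%:~R / s%:~R -> 0 < s -> coprimez r s ->
  range0 a || range1 a ->
  ~ (exists y : rat, y ^+ 2 = a - c) ->
  [\/ (m = 2 %[mod 3])%Z,
      (m = 3 %[mod 4])%Z
    | exists q : nat, [/\ prime q, (q%:Z %| s)%Z & ~ quad_residue q%:Z m]] ->
  forall sigma : tree_aut f a,
    exists g : absGalQ, arboreal_rep f a g = sigma.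
Proof.
move=> c f m Da s_gt0 co_rs ra nsq mcond.
have a0 : a != 0.
  by apply/eqP => a0; case/orP: ra => [|/andP[+ _]]; rewrite a0 ?ltxx.
apply: arboreal_surjective => [k|n S S0 x].
  (* [f] sends [a] to [- a] and fixes [- a], so the root never returns to itself. *)
  have -> : iter k.+1 (quad c) (ratr a) = ratr (- a).
    rewrite iter_quad_ratr; congr (ratr _); elim: k => [|k IHk].
      by rewrite /= /ratquad /c; ring.
    by rewrite iterS IHk /ratquad /c; ring.
  by rewrite (inj_eq (fmorph_inj _)) eq_sym -addr_eq0 -mulr2n mulrn_eq0.
under eq_bigr do rewrite crit_diffE.
rewrite -rmorph_prod -rmorphXn => /(fmorph_inj _).
exact: rat_diff_indep Da s_gt0 co_rs n S x ra a0 nsq mcond S0.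
Qed.
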